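(* Let $\delta\in(0,n]$ and $p\in[1,\infty)$. There exists a positive constant $K(n,\delta,p)$, depending only on $n,\delta,p$, with the following property. Let $w\in\mathcal A_{p,\delta}$ and let $\{Q_j\}_{j\in\mathbb N}$ be a family of non-overlapping dyadic cubes of $\mathbb R^n$. If there exists a constant $\beta\in(0,\infty)$ such that for each dyadic cube $Q$, $$\sum_{j:\,Q_j\subset Q}w_{\mathcal H^\delta_\infty}(Q_j)\le\beta\,w_{\mathcal H^\delta_\infty}(Q),$$ then for every $f\in L^1_w\left(\bigcup_{j\in\mathbb N}Q_j,\mathcal H^\delta_\infty\right)$, $$\sum_{j\in\mathbb N}\int_{Q_j}|f(x)|w(x)\,d\mathcal H^\delta_\infty\le K(n,\delta,p)\max\{1,\beta\}\,[w]_{\mathcal A_{p,\delta}}^{1+\frac1p}\int_{\bigcup_{j\in\mathbb N}Q_j}|f(x)|w(x)\,d\mathcal H^\delta_\infty.$$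
   Context: A cube $Q\subset\mathbb R^n$ is a left-open right-closed cube with sides parallel to the axes; $l(Q)$ is its edge length. Dyadic cubes are $\prod_{i=1}^n(2^{-k}m_i,2^{-k}(m_i+1)]$, $k\in\mathbb Z$, $m\in\mathbb Z^n$; non-overlapping means pairwise disjoint. For $\delta\in(0,n]$ and $E\subset\mathbb R^n$, the Hausdorff content is $\mathcal H^\delta_\infty(E):=\inf\{\sum_i l(Q_i)^\delta:\ E\subset\bigcup_i Q_i\}$, the infimum over all finite or countable coverings of $E$ by cubes. For $E\subset\mathbb R^n$ and a non-negative function $g$ (no measurability required) the Choquet integral is $\int_E g\,d\mathcal H^\delta_\infty:=\int_0^\infty \mathcal H^\delta_\infty(\{x\in E: g(x)>t\})\,dt$. ''Almost everywhere'' with respect to $\mathcal H^\delta_\infty$ means outside a set of zero $\mathcal H^\delta_\infty$-content. A capacitary weight is a non-negative function $w$ with $\int_E w\,d\mathcal H^\delta_\infty<\infty$ for all compact $E$ and $w\in(0,\infty)$ $\mathcal H^\delta_\infty$-almost everywhere; $w_{\mathcal H^\delta_\infty}(F):=\int_F w\,d\mathcal H^\delta_\infty$. $L^1_w(E,\mathcal H^\delta_\infty)$ is the set of functions $f$ with $\int_E|f|w\,d\mathcal H^\delta_\infty<\infty$. For $p\in(1,\infty)$, $w\in\mathcal A_{p,\delta}$ means $w$ is a capacitary weight with $[w]_{\mathcal A_{p,\delta}}:=\sup_Q\{\frac1{\mathcal H^\delta_\infty(Q)}\int_Qw\,d\mathcal H^\delta_\infty\}\{\frac1{\mathcal H^\delta_\infty(Q)}\int_Qw^{-\frac1{p-1}}d\mathcal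 H^\delta_\infty\}^{p-1}<\infty$ (supremum over all cubes). $w\in\mathcal A_{1,\delta}$ means $w$ is a capacitary weight with $[w]_{\mathcal A_{1,\delta}}:=\inf\{K\in(0,\infty):\ \mathcal M_{\mathcal H^\delta_\infty}w\le Kw\ \ \mathcal H^\delta_\infty\text{-a.e.}\}<\infty$, where $\mathcal M_{\mathcal H^\delta_\infty}f(x):=\sup_{Q\ni x}\frac1{\mathcal H^\delta_\infty(Q)}\int_Q|f|\,d\mathcal H^\delta_\infty$, the supremum over all cubes containing $x$. *)

(* Defs.v *)
From HB Require Import structures.
From mathcomp Require Import all_boot all_order all_algebra.
From mathcomp Require Import all_classical all_reals all_analysis.

Set Implicit Arguments.
Unset Strict Implicit.
Unset Printing Implicit Defensive.

Import Order.TTheory GRing.Theory Num.Theory.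
Import numFieldNormedType.Exports.

Local Open Scope classical_set_scope.
Local Open Scope ring_scope.
Local Open Scope ereal_scope.

Definition cube (R : realType) (n : nat) (a : 'rV[R]_n) (l : R) :
    set 'rV[R]_n :=
  [set x | forall i : 'I_n, (a 0 i < x 0 i <= a 0 i + l)%R].

Definition is_cube (R : realType) (n : nat) (Q : set 'rV[R]_n) : Prop :=
  exists (a : 'rV[R]_n) (l : R), (0 < l)%R /\ Q = cube a l.

Definition is_dyadic_cube (R : realType) (n : nat) (Q : set 'rV[R]_n) : Prop :=
  exists (k : int) (m : 'I_n -> int),
    Q = [set x : 'rV[R]_n | forall i : 'I_n,
           ((2 : R) ^ (- k) * (m i)%:~R < x 0 i
              <= (2 : R) ^ (- k) * (m i + 1)%:~R)%R].

(* A finite or countable covering is indexed by a subset D of nat. *)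
Definition hcontent (R : realType) (n : nat) (delta : R) (E : set 'rV[R]_n) :
    \bar R :=
  ereal_inf [set s | exists (D : set nat) (a : nat -> 'rV[R]_n) (l : nat -> R),
    [/\ forall i, D i -> (0 < l i)%R,
        E `<=` \bigcup_(i in D) cube (a i) (l i) &
        s = \esum_(i in D) (l i `^ delta)%:E]].

(* The integrand is nonincreasing in t, hence measurable, for every g. *)
Definition choquet (R : realType) (n : nat) (delta : R) (E : set 'rV[R]_n)
    (g : 'rV[R]_n -> \bar R) : \bar R :=
  \int[lebesgue_measure]_(t in `]0%R, +oo[)
    hcontent delta [set x | E x /\ t%:E < g x].

Definition content_ae (R : realType) (n : nat) (delta : R)
    (P : 'rV[R]_n -> Prop) : Prop :=
  exists2 N : set 'rV[R]_n, hcontent delta N = 0 & forall x, ~ N x -> P x.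

(* Weights may take the values 0 and +oo, on a set of zero content. *)
Definition capacitary_weight (R : realType) (n : nat) (delta : R)
    (w : 'rV[R]_n -> \bar R) : Prop :=
  [/\ forall x, 0 <= w x,
      forall E : set 'rV[R]_n, compact E -> choquet delta E w < +oo &
      content_ae delta (fun x => 0 < w x < +oo)].

Definition choquet_mean (R : realType) (n : nat) (delta : R)
    (Q : set 'rV[R]_n) (g : 'rV[R]_n -> \bar R) : \bar R :=
  (hcontent delta Q)^-1 * choquet delta Q g.

Definition hmaximal (R : realType) (n : nat) (delta : R)
    (f : 'rV[R]_n -> \bar R) (x : 'rV[R]_n) : \bar R :=
  ereal_sup [set choquet_mean delta Q (fun y => `|f y|) |
             Q in [set Q | is_cube Q /\ Q x]].

Definition A1_const (R : realType) (n : nat) (delta : R)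
    (w : 'rV[R]_n -> \bar R) : \bar R :=
  ereal_inf [set K%:E | K in [set K : R | (0 < K)%R /\
    content_ae delta (fun x => hmaximal delta w x <= K%:E * w x)]].

(* w ^ (- 1 / (p - 1)) is taken as the inverse of w ^ (1 / (p - 1)), where
   0^-1 = +oo and +oo^-1 = 0; the library has 0 `^ r = 0 for r < 0. *)
Definition Ap_const (R : realType) (n : nat) (delta p : R)
    (w : 'rV[R]_n -> \bar R) : \bar R :=
  ereal_sup [set choquet_mean delta Q w *
      (choquet_mean delta Q (fun x => (w x `^ (p - 1)^-1)^-1)) `^ (p - 1) |
    Q in @is_cube R n].

Definition muckenhoupt_const (R : realType) (n : nat) (delta p : R)
    (w : 'rV[R]_n -> \bar R) : \bar R :=
  if p == 1%R then A1_const delta w else Ap_const delta p w.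

Definition muckenhoupt (R : realType) (n : nat) (delta p : R)
    (w : 'rV[R]_n -> \bar R) : Prop :=
  capacitary_weight delta w /\ muckenhoupt_const delta p w < +oo.

Definition L1w (R : realType) (n : nat) (delta : R)
    (w : 'rV[R]_n -> \bar R) (E : set 'rV[R]_n) (f : 'rV[R]_n -> \bar R) :
    Prop :=
  choquet delta E (fun x => `|f x| * w x) < +oo.

(* Main.v *)
Require Import Defs.
From HB Require Import structures.
From mathcomp Require Import all_boot all_order all_algebra.
From mathcomp Require Import all_classical all_reals all_analysis.
From mathcomp Require Import measurable_realfun.
From mathcomp Require Import ring lra.
Import Order.TTheory GRing.Theory Num.Theory.
Import numFieldNormedType.Exports.
Local Open Scope classical_set_scope.
Local Open Scope ring_scope.
Local Open Scope ereal_scope.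

(** The weight disappears from the conclusion: writing [g] for [|f| w], the
    claim is that [\sum_j \int_(Q_j) g dH <= C \int_(\bigcup_j Q_j) g dH] for
    an arbitrary nonnegative [g].  This holds as soon as the cubes satisfy a
    packing condition for the content itself,
    [\sum_(Q_j <= P) H(Q_j) <= S H(P)] for all dyadic [P], with [C] a multiple
    of [S] ([choquet_packing]).  Indeed, it is enough to treat the level sets
    of [g]; covering a level set by cubes, and each of these by [2 ^ n] dyadic
    cubes of comparable size, reduces the matter to
    [\sum_j H(P `&` Q_j) <= S H(P)] for [P] dyadic, where either all [Q_j] that
    meet [P] lie in [P], or a single one contains [P].

    It remains to deduce the packing condition for [H] from the one for [w].
    For [1 < p] put [sigma = w ^ (- 1 / (p - 1))].  On a cube [P], choose
    thresholds [a = b ^ (- (p - 1))] such that [w >= a] or [sigma >= b] almost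
    everywhere, with [b] so large that [\int_P sigma dH <= theta b H(P)]; the
    Muckenhoupt condition then says that [\int_P w dH <= c W a H(P)], where
    [W] is the constant of [w].  For [p = 1] the weight is bounded below by a
    multiple of its mean, and [sigma] can be replaced by [0].  Both cases are
    summed up in [weight_test].

    Let [S] be any packing constant of a finite subfamily.  Summing
    [H(Q_j) <= a^-1 \int_(Q_j) w dH + b^-1 \int_(Q_j) sigma dH] over the
    [Q_j] in [P], the first terms are controlled by the hypothesis on [w] and
    the second ones by [choquet_packing] with the constant [S] itself.  With
    [theta] small this gives the new packing constant [S / 2 + beta c W]
    ([packing_self_improve]), so that by iteration [S] may be taken to be
    [2 + 2 beta c W] whatever the subfamily ([packing_bound]).  Since [W] is
    bounded below, [2 + 2 beta c W] is at most a multiple of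
    [max(1, beta) W ^ (1 + 1 / p)]. *)

(** * The Hausdorff content as an outer measure *)

Lemma esumZl_le {R : realType} {T : choiceType} (D : set T) (c : R)
    (a : T -> \bar R) :
  (0 <= c)%R -> (forall i, 0 <= a i) ->
  \esum_(i in D) (c%:E * a i) <= c%:E * \esum_(i in D) a i.
Proof.
move=> c_ge0 a_ge0; apply: ge_ereal_sup => _ [X [finX XD] <-].
rewrite -ge0_mule_fsumr//; apply: lee_wpmul2l; first by rewrite lee_fin.
by apply: ereal_sup_ubound; exists X.
Qed.

Lemma sum_le_esum {R : realType} {I : choiceType} (s : seq I) (P : pred I)
    (D : set I) (a : I -> \bar R) :
  uniq s -> (forall i, P i -> D i) ->
  \sum_(i <- s | P i) a i <= \esum_(i in D) a i.
Proof.
move=> s_uniq PD; apply: esum_ge; exists [set` [seq i <- s | P i]].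
  split; first exact: finite_seq.
  by move=> i /=; rewrite mem_filter => /andP[/PD].
by rewrite -big_filter fsbig_seq// filter_uniq.
Qed.

Lemma hcontent_ge0 {R : realType} {n : nat} (delta : R) (E : set 'rV[R]_n) :
  0 <= hcontent delta E.
Proof.
apply/ereal_infP => _ [D [a [l [_ _ ->]]]].
by apply: esum_ge0 => i _; rewrite lee_fin powR_ge0.
Qed.

(** Coverings indexed by an arbitrary countable type are transported to [nat]
    by [pickle]; double indices are what subadditivity requires. *)
Lemma hcontent_le_cover {R : realType} {n : nat} (delta : R) (T : countType)
    (D : set T) (a : T -> 'rV[R]_n) (l : T -> R) (E : set 'rV[R]_n) :
  (forall i, D i -> (0 < l i)%R) ->
  E `<=` \bigcup_(i in D) cube (a i) (l i) ->
  hcontent delta E <= \esum_(i in D) (l i `^ delta)%:E.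
Proof.
move=> l_gt0 cover_E; apply: ge_ereal_inf.
exists (\esum_(i in pickle @` D)
          (oapp l 1%R (unpickle i) `^ delta)%:E) => //.
  (* every index in pickle @` D decodes, so the defaults 0 and 1 do not matter *)
  exists (pickle @` D), (oapp a 0%R \o unpickle), (oapp l 1%R \o unpickle).
  split => [_ [i Di <-]|x Ex|//] /=; first by rewrite pickleK; exact: l_gt0.
  have [i Di xi] := cover_E _ Ex.
  by exists (pickle i); [exists i | rewrite /= pickleK].
rewrite esum_image => [|i j _ _]; last exact: (pcan_inj pickleK).
by under eq_esum do rewrite pickleK.
Qed.

Lemma hcontent_cube_le {R : realType} {n : nat} (delta : R)
    (a : 'rV[R]_n) (l : R) :
  (0 < l)%R -> hcontent delta (cube a l) <= (l `^ delta)%:E.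
Proof.
move=> l_gt0.
have := @hcontent_le_cover R n delta unit setT (fun=> a) (fun=> l) (cube a l).
rewrite (_ : [set: unit] = [set tt]); last by apply/seteqP; split => [[]|].
rewrite esum_set1 ?lee_fin ?powR_ge0//; apply => [//|x ax].
by exists tt.
Qed.

Lemma hcontent0 {R : realType} {n : nat} (delta : R) :
  hcontent delta (@set0 'rV[R]_n) = 0.
Proof.
apply/eqP; rewrite eq_le hcontent_ge0 andbT.
have := @hcontent_le_cover R n delta nat set0 (fun=> 0%R) (fun=> 1%R) set0.
by rewrite esum_set0; apply => [//|x []].
Qed.

Lemma le_hcontent {R : realType} {n : nat} (delta : R) :
  {homo (@hcontent R n delta) : A B / A `<=` B >-> A <= B}.
Proof.
move=> A B AB; apply: ereal_inf_le_tmp => _ [D [a [l [l_gt0 cB ->]]]].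
by exists D, a, l; split => //; exact: subset_trans cB.
Qed.

(** Coverings of the [A k] that are optimal up to [e / 2 ^ k.+1] together form
    a covering of the union. *)
Lemma hcontent_sigma_subadditive {R : realType} {n : nat} (delta : R) :
  sigma_subadditive (@hcontent R n delta).
Proof.
move=> A; have [[i ioo]|/forallNP Aoo] :=
    pselect (exists i, hcontent delta (A i) = +oo).
  rewrite (eseries_pinfty _ _ ioo) ?leey// => k _.
  by rewrite -ltNye (lt_le_trans _ (hcontent_ge0 _ _)).
apply/lee_addgt0Pr => e e_gt0.
apply: le_trans (epsilon_trick _ _ (ltW e_gt0)) => [|k]; last first.
  exact: hcontent_ge0.
pose P k (F : set nat * (nat -> 'rV[R]_n) * (nat -> R)) :=
  [/\ forall i, F.1.1 i -> (0 < F.2 i)%R,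
      A k `<=` \bigcup_(i in F.1.1) cube (F.1.2 i) (F.2 i) &
      \esum_(i in F.1.1) (F.2 i `^ delta)%:E
        <= hcontent delta (A k) + (e / (2 ^ k.+1)%:R)%:E].
have [F PF] : {F & forall k, P k (F k)}.
  apply: (@choice _ _ P) => k.
  have e_k : (0 < e / (2 ^ k.+1)%:R)%R by rewrite divr_gt0// ltr0n expn_gt0.
  have /(lb_ereal_inf_adherent e_k) : hcontent delta (A k) \is a fin_num.
    by rewrite ge0_fin_numE ?hcontent_ge0// ltey; apply/eqP.
  move=> [_ [D [a [l [l_gt0 cA ->]]]] lt_e].
  by exists (D, a, l); split => //; exact: ltW.
pose D := [set: nat] `*`` fun k => (F k).1.1.
apply: (@le_trans _ _ (\esum_(i in D) ((F i.1).2 i.2 `^ delta)%:E)).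
  apply: (@hcontent_le_cover _ _ _ _ _ (fun i => (F i.1).1.2 i.2)) => [[k i] []|].
    by have [l_gt0 _ _] := PF k => _ /= /l_gt0.
  move=> x [k _ Akx]; have [_ cA _] := PF k.
  by have [i Fi xi] := cA _ Akx; exists (k, i).
rewrite -(@esum_esum R _ _ setT (fun k => (F k).1.1)
           (fun k i => ((F k).2 i `^ delta)%:E)) => [|k i _ _]; last first.
  by rewrite lee_fin powR_ge0.
rewrite nneseries_esumT => [|k]; last first.
  by rewrite adde_ge0 ?hcontent_ge0// lee_fin divr_ge0 ?ltW// ltr0n expn_gt0.
by apply: le_esum => k _; have [] := PF k.
Qed.

HB.instance Definition _ (R : realType) (n : nat) (delta : R) :=
  isOuterMeasure.Build R 'rV[R]_n (@hcontent R n delta)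
    (hcontent0 delta) (hcontent_ge0 delta) (le_hcontent delta)
    (hcontent_sigma_subadditive delta).

Lemma hcontentU {R : realType} {n : nat} (delta : R) (A B : set 'rV[R]_n) :
  hcontent delta (A `|` B) <= hcontent delta A + hcontent delta B.
Proof. exact: outer_measureU2. Qed.

Lemma hcontent_bigcup_eq0 {R : realType} {n : nat} (delta : R)
    (A : nat -> set 'rV[R]_n) :
  (forall k, hcontent delta (A k) = 0) -> hcontent delta (\bigcup_k A k) = 0.
Proof.
move=> A0; apply/eqP; rewrite eq_le hcontent_ge0 andbT.
by apply: le_trans (hcontent_sigma_subadditive delta A) _; rewrite eseries0.
Qed.

Lemma hcontent_cube_fin_num {R : realType} {n : nat} (delta : R)
    (Q : set 'rV[R]_n) : is_cube Q -> hcontent delta Q \is a fin_num.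
Proof.
move=> [a [l [l_gt0 ->]]]; rewrite ge0_fin_numE ?hcontent_ge0//.
by apply: le_lt_trans (hcontent_cube_le _ _ _ l_gt0) _; rewrite ltry.
Qed.

Lemma hcontent_bigcup_le {R : realType} {n : nat} (delta : R) (D : set nat)
    (A : nat -> set 'rV[R]_n) :
  hcontent delta (\bigcup_(i in D) A i) <= \esum_(i in D) hcontent delta (A i).
Proof.
rewrite esum_mkcond -nneseries_esumT => [|i]; last first.
  by case: ifP => // _; exact: hcontent_ge0.
rewrite bigcup_mkcond.
apply: le_trans (hcontent_sigma_subadditive delta _) _.
apply: lee_nneseries => [i _ _|i _]; first exact: hcontent_ge0.
by case: ifP => // _; rewrite hcontent0.
Qed.

Lemma hcontent_le_sum {R : realType} {n : nat} (delta : R) (I : eqType)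
    (s : seq I) (A : I -> set 'rV[R]_n) (E : set 'rV[R]_n) :
  (forall x, E x -> exists2 i, i \in s & A i x) ->
  hcontent delta E <= \sum_(i <- s) hcontent delta (A i).
Proof.
elim: s E => [|i s IHs] E cover_E.
  rewrite big_nil (_ : E = set0) ?hcontent0//.
  by apply/seteqP; split => // x /cover_E[].
rewrite big_cons; apply: le_trans (_ : _ <= hcontent delta (A i `|` (E `\` A i))) _.
  by apply: le_hcontent => x Ex; case: (pselect (A i x)); [left|right].
apply: le_trans (hcontentU _ _ _) _; apply: leeD2l; apply: IHs => x [/cover_E[j]].
by rewrite inE => /predU1P[-> //|js Ajx _]; exists j.
Qed.

(** The map carrying one cube to the other carries coverings to coverings. *)
Lemma hcontent_cube_affine {R : realType} {n : nat} (delta : R)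
    (a b : 'rV[R]_n) (l m : R) :
  (0 < l)%R -> (0 < m)%R ->
  hcontent delta (cube b m)
    <= ((m / l) `^ delta)%:E * hcontent delta (cube a l).
Proof.
move=> l_gt0 m_gt0; set r : R := (m / l)%R.
have r_gt0 : (0 < r)%R by rewrite divr_gt0.
rewrite -lee_pdivrMl ?powR_gt0//; apply/ereal_infP => _ [D [c [k [k_gt0 cover ->]]]].
rewrite lee_pdivrMl ?powR_gt0//.
apply: le_trans (_ : _ <= \esum_(i in D) (((r * k i) `^ delta)%:E)) _.
  apply: (@hcontent_le_cover _ _ _ _ _ (fun i => b + r *: (c i - a))%R).
    by move=> i Di; rewrite mulr_gt0// k_gt0.
  move=> x bx; have [|i Di xi] := cover (a + r^-1 *: (x - b))%R.
    move=> i; have := bx i; rewrite !mxE ltrDl lerD2l.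
    rewrite pmulr_rgt0 ?invr_gt0// subr_gt0 => /andP[-> /=].
    rewrite -lerBlDl => xm; rewrite mulrC ler_pdivrMr// /r mulrCA divff ?gt_eqF// mulr1.
    exact: xm.
  exists i => // j; have := xi j; rewrite !mxE.
  have xE : (x 0 j = b 0 j + r * (r^-1 * (x 0 j - b 0 j)))%R.
    by rewrite mulrA divff ?gt_eqF// mul1r addrC subrK.
  move: xE; set y : R := (r^-1 * _)%R => -> /andP[y1 y2]; rewrite -addrA -mulrDr.
  by rewrite ltrD2l lerD2l ltr_pM2l// ler_pM2l//; apply/andP; split; lra.
apply: le_trans (esumZl_le _ _ _ (powR_ge0 _ _) _) => [|i]; last first.
  by rewrite lee_fin powR_ge0.
apply: le_esum => i Di; rewrite -EFinM lee_fin powRM// ltW//.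
exact: k_gt0.
Qed.

(** Dilated copies of the null cube exhaust the space.  The content is therefore
    either identically zero or positive on every cube. *)
Lemma hcontent_null_cube {R : realType} {n : nat} (delta : R)
    (a : 'rV[R]_n) (l : R) (E : set 'rV[R]_n) :
  (0 < l)%R -> hcontent delta (cube a l) = 0 -> hcontent delta E = 0.
Proof.
move=> l_gt0 cube0; apply/eqP; rewrite eq_le hcontent_ge0 andbT.
have <- : hcontent delta
    (\bigcup_k @cube R n (const_mx (- k.+1%:R)) (2 * k.+1%:R))%R = 0.
  apply: hcontent_bigcup_eq0 => k; apply/eqP; rewrite eq_le hcontent_ge0 andbT.
  apply: le_trans (hcontent_cube_affine _ a _ _ _ l_gt0 _) _.
    by rewrite mulr_gt0.
  by rewrite cube0 mule0.
apply: le_hcontent => x _.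
pose M : R := (\sum_(i < n) `|x 0 i|)%R.
exists (Num.truncn M) => // i; rewrite mxE.
have xM : (`|x 0 i| < (Num.truncn M).+1%:R)%R.
  apply: le_lt_trans (truncnS_gt M).
  by rewrite /M (bigD1 i)//= lerDl sumr_ge0.
have /andP[x1 x2] : (- (Num.truncn M).+1%:R < x 0 i < (Num.truncn M).+1%:R)%R by rewrite -ltr_norml.
by rewrite x1 /=; lra.
Qed.

(** * The Choquet integral *)

Lemma nonincreasing_emeasurable_fun {R : realType} (D : set R)
    (h : R -> \bar R) :
  measurable D -> (forall s t : R, (s <= t)%R -> h t <= h s) ->
  measurable_fun D h.
Proof.
move=> mD h_noninc; apply: (@measurable_funS _ _ _ _ setT) => //.
move=> _; apply: (measurability _ (ErealGenOInfty.measurableE R)) => //.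
move=> _ [_ [x ->] <-]; rewrite setTI; apply: is_interval_measurable.
move=> s t /= sx tx u /andP[su ut]; move: tx.
rewrite !in_itv/= !andbT => tx.
exact: lt_le_trans tx (h_noninc _ _ ut).
Qed.

Lemma measurable_choquet_integrand {R : realType} {n : nat} (delta : R)
    (E : set 'rV[R]_n) (g : 'rV[R]_n -> \bar R) (D : set R) :
  measurable D ->
  measurable_fun D (fun t => hcontent delta [set x | E x /\ t%:E < g x]).
Proof.
move=> mD; apply: nonincreasing_emeasurable_fun => // s t st.
apply: le_hcontent => x [Ex tx]; split => //.
by rewrite (le_lt_trans _ tx)// lee_fin.
Qed.

Lemma choquet_ge0 {R : realType} {n : nat} (delta : R) (E : set 'rV[R]_n)
    (g : 'rV[R]_n -> \bar R) : 0 <= choquet delta E g.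
Proof. by apply: integral_ge0 => t _; exact: hcontent_ge0. Qed.

Lemma le_choquet {R : realType} {n : nat} (delta : R) (A B : set 'rV[R]_n)
    (g : 'rV[R]_n -> \bar R) :
  A `<=` B -> choquet delta A g <= choquet delta B g.
Proof.
move=> AB; apply: ge0_le_integral => //.
- by move=> t _; exact: hcontent_ge0.
- exact: measurable_choquet_integrand.
- exact: measurable_choquet_integrand.
- by move=> t _; apply: le_hcontent => x [/AB].
Qed.

Lemma choquet_eq0 {R : realType} {n : nat} (delta : R) (E : set 'rV[R]_n)
    (g : 'rV[R]_n -> \bar R) :
  hcontent delta E = 0 -> choquet delta E g = 0.
Proof.
move=> E0; apply: integral0_eq => t _; apply/eqP.
rewrite eq_le hcontent_ge0 andbT -E0.
by apply: le_hcontent => x [].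
Qed.

Lemma choquet_cst0 {R : realType} {n : nat} (delta : R) (E : set 'rV[R]_n) :
  choquet delta E (fun=> 0) = 0.
Proof.
apply: integral0_eq => t; rewrite /= in_itv/= andbT => t_gt0.
rewrite (_ : [set _ | _] = set0) ?hcontent0//.
by apply/seteqP; split => // x [_]; rewrite lte_fin ltNge (ltW t_gt0).
Qed.

(** The integrand is at least [hcontent delta [set x | E x /\ b%:E <= g x]] for
    [0 < t < b]. *)
Lemma choquet_markov {R : realType} {n : nat} (delta : R) (E : set 'rV[R]_n)
    (g : 'rV[R]_n -> \bar R) (b : R) :
  (0 < b)%R ->
  b%:E * hcontent delta [set x | E x /\ b%:E <= g x] <= choquet delta E g.
Proof.
move=> b_gt0; set h := hcontent _ _.
have -> : b%:E * h = \int[lebesgue_measure]_(t in `]0%R, b[) cst h t.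
  rewrite integral_cst//= lebesgue_measure_itv/= lte_fin b_gt0.
  by rewrite oppr0 adde0 muleC.
apply: (@le_trans _ _ (\int[lebesgue_measure]_(t in `]0%R, b[)
    hcontent delta [set x | E x /\ t%:E < g x])).
  apply: ge0_le_integral => //.
  - by move=> t _; exact: hcontent_ge0.
  - exact: measurable_choquet_integrand.
  - move=> t /=; rewrite in_itv/= => /andP[_ tb]; apply: le_hcontent => x [Ex bx].
    by split => //; rewrite (lt_le_trans _ bx)// lte_fin.
apply: ge0_subset_integral => //.
- exact: measurable_choquet_integrand.
- by move=> t _; exact: hcontent_ge0.
- by move=> t /=; rewrite !in_itv/= andbT => /andP[].
Qed.

(** If the integral vanished, so would the content of each level set
    [g >= 1 / k.+1], by Markov's inequality, and these exhaust [E] up to a null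
    set. *)
Lemma choquet_gt0 {R : realType} {n : nat} (delta : R) (E : set 'rV[R]_n)
    (g : 'rV[R]_n -> \bar R) :
  0 < hcontent delta E -> content_ae delta (fun x => E x -> 0 < g x) ->
  0 < choquet delta E g.
Proof.
move=> E_gt0 [N N0 gN]; rewrite lt0e choquet_ge0 andbT.
apply/eqP => int0; move: E_gt0; apply/negP; rewrite -leNgt.
have level0 (k : nat) :
    hcontent delta [set x | E x /\ (k.+1%:R^-1)%:E <= g x] = 0.
  have k_gt0 : (0 < (k.+1%:R : R)^-1)%R by rewrite invr_gt0.
  have := choquet_markov delta E g _ k_gt0; rewrite int0.
  rewrite pmule_rle0 ?lte_fin// => le0.
  by apply/eqP; rewrite eq_le le0 hcontent_ge0.
apply: (@le_trans _ _ (hcontent delta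
    (N `|` \bigcup_k [set x | E x /\ (k.+1%:R^-1)%:E <= g x]))).
  apply: le_hcontent => x Ex.
  have [Nx|/gN/(_ Ex) gx] := pselect (N x); [by left|right].
  case gxE: (g x) gx => [r| |] gx //.
    exists (Num.truncn r^-1) => //; split => //.
    rewrite gxE lee_fin; rewrite lte_fin in gx.
    rewrite -[leRHS]invrK lef_pV2 ?posrE ?invr_gt0//.
    exact/ltW/truncnS_gt.
  by exists 0%N => //; split => //; rewrite gxE leey.
apply: le_trans (hcontentU _ _ _) _.
by rewrite N0 add0e hcontent_bigcup_eq0.
Qed.

(** Choquet integration preserves a superadditivity estimate of the content:
    the hypothesis is applied to the level sets of [g]. *)
Lemma sum_choquet_le {R : realType} {n : nat} (delta C : R)
    (I : Type) (s : seq I) (P : I -> set 'rV[R]_n) (E : set 'rV[R]_n)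
    (g : 'rV[R]_n -> \bar R) :
  (0 <= C)%R ->
  (forall A : set 'rV[R]_n, A `<=` E ->
     \sum_(j <- s) hcontent delta (A `&` P j) <= C%:E * hcontent delta A) ->
  \sum_(j <- s) choquet delta (E `&` P j) g <= C%:E * choquet delta E g.
Proof.
move=> C_ge0 sumC; rewrite -ge0_integral_sum//; last 2 first.
- by move=> j; exact: measurable_choquet_integrand.
- by move=> j t _; exact: hcontent_ge0.
rewrite -ge0_integralZl_EFin//; last 2 first.
- by move=> t _; exact: hcontent_ge0.
- exact: measurable_choquet_integrand.
apply: ge0_le_integral => //.
- by move=> t _; apply: sume_ge0 => j _; exact: hcontent_ge0.
- by apply: emeasurable_sum => j; exact: measurable_choquet_integrand.
- by apply: measurable_funeM; exact: measurable_choquet_integrand.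
- move=> t _; apply: le_trans (sumC _ _); last by move=> x [].
  apply: lee_sum => j _; apply: le_hcontent => x [[Ex Px] tx].
  by split => //; split.
Qed.

(** * Dyadic cubes *)

Lemma is_dyadic_is_cube {R : realType} {n : nat} (D : set 'rV[R]_n) :
  is_dyadic_cube D -> is_cube D.
Proof.
move=> [k [m ->]]; exists (\row_i ((2 : R) ^ (- k) * (m i)%:~R))%R, ((2 : R) ^ (- k))%R.
split; first by rewrite exprz_gt0.
by apply/seteqP; split => x xD i; move: (xD i); rewrite !mxE intrD mulrDr mulr1.
Qed.

(** A coarse side length is an integer multiple [N] of a finer one, so along
    each axis two dyadic intervals that meet compare by integer arithmetic. *)
Lemma dyadic_nested {R : realType} {n : nat} (D D' : set 'rV[R]_n) :
  is_dyadic_cube D -> is_dyadic_cube D' ->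
  [\/ D `&` D' = set0, D `<=` D' | D' `<=` D].
Proof.
move=> [k [m ->]] [k' [m' ->]].
wlog kk' : k k' m m' / (k <= k')%R => [wlog_kk'|].
  have [kk'|/ltW kk'] := leP k k'; first exact: wlog_kk'.
  by have [E|?|?] := wlog_kk' _ _ m' m kk'; [rewrite setIC; constructor 1|constructor 3|constructor 2].
set A := [set x | _]; set B := [set x | _].
have [->|/set0P[x [Ax Bx]]] := eqVneq (A `&` B) set0; first by constructor 1.
constructor 3.
pose N : int := (2 ^ `|k' - k|)%N.
have NE : ((2 : R) ^ (- k) = (2 : R) ^ (- k') * N%:~R)%R.
  have -> : (N%:~R = (2 : R) ^ (k' - k))%R.
    rewrite -[in RHS](gez0_abs (_ : 0 <= k' - k)%R) ?subr_ge0//.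
    by rewrite /N -exprnP -natrX.
  by rewrite -expfzDr ?pnatr_eq0// addrA addNr add0r.
move=> y By i; move: (Ax i) (Bx i) (By i); rewrite NE -!mulrA -!intrM.
have u_gt0 : (0 < (2 : R) ^ (- k'))%R by rewrite exprz_gt0.
move=> /andP[A1 A2] /andP[B1 B2] /andP[y1 y2].
have := lt_le_trans A1 B2; rewrite ltr_pM2l// ltr_int ltzD1 => lo.
have := lt_le_trans B1 A2; rewrite ltr_pM2l// ltr_int -lezD1 => hi.
apply/andP; split.
  by rewrite (le_lt_trans _ y1)// ler_pM2l// ler_int.
by rewrite (le_trans y2)// ler_pM2l// ler_int.
Qed.

(** With [u] the power of [2] in [[l, 2 l]], an interval of length [l] meets at
    most two dyadic intervals of length [u]: the one containing points just to
    the right of its left end, and the next.  An index of [F] selects one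
    of the two along each axis. *)
Lemma cube_dyadic_cover {R : realType} {n : nat} (delta : R)
    (a : 'rV[R]_n) (l : R) :
  (0 < delta)%R -> (0 < l)%R ->
  exists F : {ffun 'I_n -> bool} -> set 'rV[R]_n,
    [/\ forall b, is_dyadic_cube (F b),
        forall b, hcontent delta (F b) <= ((2 * l) `^ delta)%:E &
        forall x, cube a l x -> exists b, F b x].
Proof.
move=> delta_gt0 l_gt0.
have [k [lk kl]] : exists k : int, (l <= (2 : R) ^ (- k) /\ (2 : R) ^ (- k) <= 2 * l)%R.
  pose j := Num.ceil (ln l / ln 2).
  exists (- j)%R; rewrite opprK.
  have ln2 : (0 < ln (2 : R))%R by rewrite ln_gt0// ltr1n.
  have E (r : int) : (((2 : R) ^ r)%R = expR (r%:~R * ln 2)).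
    by rewrite -powR_intmul// /powR pnatr_eq0.
  have /andP[lo hi] := ceil_itv (ln l / ln 2).
  split; first by rewrite E -[leLHS]lnK ?posrE// ler_expR -ler_pdivrMr.
  rewrite -ler_pdivrMl// -[(2^-1)%R]/((2 : R) ^ (-1))%R -expfzDr ?pnatr_eq0// addrC.
  by rewrite E -[leRHS]lnK ?posrE// ler_expR -ler_pdivlMr// ltW.
set u : R := ((2 : R) ^ (- k))%R in lk kl.
have u_gt0 : (0 < u)%R by rewrite exprz_gt0.
pose m (b : {ffun 'I_n -> bool}) i : int := (Num.floor (a 0%R i / u) + b i)%R.
pose F b := [set x : 'rV[R]_n | forall i,
  (u * (m b i)%:~R < x 0 i <= u * (m b i + 1)%:~R)%R].
have dyF b : is_dyadic_cube (F b) by exists k, (m b).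
exists F; split => // [b|x ax].
  have [c [r [r_gt0 FE]]] := is_dyadic_is_cube _ (dyF b).
  apply: le_trans (_ : _ <= (u `^ delta)%:E) _; last first.
    rewrite lee_fin; apply: ge0_ler_powR => //; rewrite ?nnegrE ltW//.
    by rewrite mulr_gt0.
  have -> : F b = cube (\row_i (u * (m b i)%:~R)%R) u.
    by apply/seteqP; split => x xD i; move: (xD i); rewrite !mxE intrD mulrDr mulr1.
  exact: hcontent_cube_le.
exists [ffun i => (u * (Num.floor (a 0%R i / u) + 1)%:~R < x 0 i)%R] => i.
rewrite /m ffunE; have /andP[a1 a2] := ax i.
have := floor_itv (a 0%R i / u)%R.
rewrite ler_pdivlMr// ltr_pdivrMr// ![(_ * u)%R]mulrC => /andP[lo hi].
case: (ltP (u * (Num.floor (a 0%R i / u) + 1)%:~R)%R) => xi /=.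
  rewrite xi /= (le_trans a2)// [leRHS](_ : _ = u * (Num.floor (a 0%R i / u) + 1)%:~R + u)%R.
    by rewrite lerD// ltW.
  by rewrite intrD mulrDr mulr1.
by rewrite addr0 xi andbT (le_lt_trans lo a1).
Qed.

(** * Packing for the content *)

(** Either [P] lies in a single [Q i], disjoint from the other cubes, or every
    [Q j] meeting [P] lies in [P]. *)
Lemma hcontent_packing_dyadic {R : realType} {n : nat} (delta S : R)
    (s : seq nat) (Q : nat -> set 'rV[R]_n) (P : set 'rV[R]_n) :
  uniq s -> (forall j, is_dyadic_cube (Q j)) -> trivIset setT Q -> (1 <= S)%R ->
  is_dyadic_cube P ->
  \sum_(j <- s | `[< Q j `<=` P >]) hcontent delta (Q j)
    <= S%:E * hcontent delta P ->
  \sum_(j <- s) hcontent delta (P `&` Q j) <= S%:E * hcontent delta P.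
Proof.
move=> s_uniq dyQ tQ S_ge1 dyP packP.
have [[i [si PQi]]|noQ] := pselect (exists i, i \in s /\ P `<=` Q i).
  rewrite (bigD1_seq i)//= [X in _ + X]big1 => [|j ji].
    rewrite adde0; apply: le_trans (_ : _ <= hcontent delta P) _.
      by apply: le_hcontent => x [].
    by rewrite -[leLHS]mul1e lee_wpmul2r ?hcontent_ge0// lee_fin.
  rewrite (_ : P `&` Q j = set0) ?hcontent0//.
  apply/seteqP; split => // x [/PQi Qix Qjx].
  by move/eqP: ji; apply; apply: (tQ j i) => //; exists x.
apply: le_trans packP; rewrite [leRHS]big_mkcond/=.
rewrite !big_seq; apply: lee_sum => j js; case: asboolP => [_|nQP].
  by apply: le_hcontent => x [].
have [->|PQ|//] := dyadic_nested _ _ dyP (dyQ j); first by rewrite hcontent0.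
by case: noQ; exists j.
Qed.

Definition content_packing {R : realType} {n : nat} (delta : R) (s : seq nat)
    (Q : nat -> set 'rV[R]_n) (S : R) : Prop :=
  forall P, is_dyadic_cube P ->
    \sum_(j <- s | `[< Q j `<=` P >]) hcontent delta (Q j)
      <= S%:E * hcontent delta P.

(** By subadditivity the estimate for dyadic cubes extends to all cubes, at the
    cost of the [2 ^ n] dyadic cubes and of their side length, at most twice the
    given one; then it extends to [E] by summation over a covering. *)
Lemma hcontent_packing {R : realType} {n : nat} (delta S : R)
    (s : seq nat) (Q : nat -> set 'rV[R]_n) (E : set 'rV[R]_n) :
  (0 < delta)%R ->
  uniq s -> (forall j, is_dyadic_cube (Q j)) -> trivIset setT Q -> (1 <= S)%R ->
  content_packing delta s Q S ->
  \sum_(j <- s) hcontent delta (E `&` Q j)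
    <= ((2 ^ n)%:R * 2 `^ delta * S)%:E * hcontent delta E.
Proof.
move=> delta_gt0 s_uniq dyQ tQ S_ge1 packS; set C : R := (_ * S)%R.
have S_gt0 : (0 < S)%R by exact: lt_le_trans S_ge1.
have C_gt0 : (0 < C)%R by rewrite !mulr_gt0 ?powR_gt0// ltr0n expn_gt0.
have pack_cube (a : 'rV[R]_n) (l : R) : (0 < l)%R ->
    \sum_(j <- s) hcontent delta (cube a l `&` Q j) <= C%:E * (l `^ delta)%:E.
  move=> l_gt0; have [F [dyF Fle Fcover]] := cube_dyadic_cover _ a l delta_gt0 l_gt0.
  apply: le_trans (_ : _ <= \sum_(j <- s)
      \sum_(b : {ffun 'I_n -> bool}) hcontent delta (F b `&` Q j)) _.
    apply: lee_sum => j _; apply: hcontent_le_sum => x [/Fcover[b Fbx] Qx].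
    by exists b; rewrite ?mem_index_enum.
  rewrite exchange_big/=.
  apply: le_trans (_ : _ <= \sum_(b : {ffun 'I_n -> bool}) (S * (2 * l) `^ delta)%:E) _.
    apply: lee_sum => b _.
    apply: le_trans (hcontent_packing_dyadic _ S _ _ (F b) s_uniq dyQ tQ S_ge1 (dyF b) _) _.
      exact: packS.
    by rewrite EFinM lee_pmul2l// lte_fin.
  rewrite sumEFin -EFinM lee_fin sumr_const card_ffun card_bool card_ord.
  rewrite (powRM _ (ler0n _ 2) (ltW l_gt0)) -[(_ *+ _)%R]mulr_natl /C.
  by rewrite le_eqVlt; apply/orP; left; apply/eqP; ring.
rewrite -lee_pdivrMl//; apply/ereal_infP => _ [D [a [l [l_gt0 cover ->]]]].
rewrite lee_pdivrMl//.
apply: le_trans (_ : _ <= \sum_(j <- s)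
    \esum_(i in D) hcontent delta (cube (a i) (l i) `&` Q j)) _.
  apply: lee_sum => j _; apply: le_trans (hcontent_bigcup_le _ _ _).
  by apply: le_hcontent => x [/cover[i Di xi] Qx]; exists i.
rewrite -esum_sum => [|i j _ _]; last exact: hcontent_ge0.
apply: le_trans (esumZl_le _ _ _ (ltW C_gt0) _) => [|i]; last by rewrite lee_fin powR_ge0.
by apply: le_esum => i Di; apply: pack_cube; exact: l_gt0.
Qed.

Lemma choquet_packing {R : realType} {n : nat} (delta S : R)
    (s : seq nat) (Q : nat -> set 'rV[R]_n) (E : set 'rV[R]_n)
    (g : 'rV[R]_n -> \bar R) :
  (0 < delta)%R ->
  uniq s -> (forall j, is_dyadic_cube (Q j)) -> trivIset setT Q -> (1 <= S)%R ->
  content_packing delta s Q S ->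
  \sum_(j <- s) choquet delta (E `&` Q j) g
    <= ((2 ^ n)%:R * 2 `^ delta * S)%:E * choquet delta E g.
Proof.
move=> delta_gt0 s_uniq dyQ tQ S_ge1 packS; apply: sum_choquet_le => [|A _].
  by rewrite !mulr_ge0 ?powR_ge0// (le_trans ler01).
exact: hcontent_packing.
Qed.

(** * Muckenhoupt weights *)

Lemma choquet_weight_cube_lty {R : realType} {n : nat} (delta : R)
    (w : 'rV[R]_n -> \bar R) (Q : set 'rV[R]_n) :
  capacitary_weight delta w -> is_cube Q -> choquet delta Q w < +oo.
Proof.
move=> [_ w_lty _] [a [l [_ ->]]].
pose B := [set x : 'rV[R]_n | forall i, x ord0 i \in `[(a ord0 i), (a ord0 i + l)%R]].
apply: (@le_lt_trans _ _ (choquet delta B w)).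
  apply: le_choquet => x ax i; rewrite in_itv/=.
  by have /andP[/ltW] := ax i; rewrite -[0%R]/ord0 => -> ->.
apply: w_lty; apply: (@rV_compact R n (fun i => [set` `[a ord0 i, (a ord0 i + l)%R]])).
by move=> i; exact: segment_compact.
Qed.

(** [E] is covered up to a null set by the level sets [w >= a] and [g >= b], to
    which Markov's inequality applies. *)
Lemma hcontent_le_levels {R : realType} {n : nat} (delta : R)
    (w g : 'rV[R]_n -> \bar R) (Q E : set 'rV[R]_n) (a b : R) :
  (0 < a)%R -> (0 < b)%R -> E `<=` Q ->
  content_ae delta (fun x => Q x -> a%:E <= w x \/ b%:E <= g x) ->
  hcontent delta E
    <= a^-1%:E * choquet delta E w + b^-1%:E * choquet delta E g.
Proof.
move=> a_gt0 b_gt0 EQ [N N0 wg].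
have level (v : 'rV[R]_n -> \bar R) (t : R) : (0 < t)%R ->
    hcontent delta [set x | E x /\ t%:E <= v x] <= t^-1%:E * choquet delta E v.
  by move=> t_gt0; rewrite lee_pdivlMl//; exact: choquet_markov.
apply: le_trans (leeD (level w a a_gt0) (level g b b_gt0)).
apply: le_trans (hcontentU _ _ _).
apply: le_trans (_ : _ <= hcontent delta
  (N `|` ([set x | E x /\ a%:E <= w x] `|` [set x | E x /\ b%:E <= g x]))) _.
  apply: le_hcontent => x Ex.
  have [Nx|/wg/(_ (EQ _ Ex))[wx|gx]] := pselect (N x); first by left.
    by right; left.
  by right; right.
by apply: le_trans (hcontentU _ _ _) _; rewrite N0 add0e.
Qed.

Lemma choquet_weight_gt0 {R : realType} {n : nat} (delta : R)
    (w : 'rV[R]_n -> \bar R) (Q : set 'rV[R]_n) :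
  capacitary_weight delta w -> 0 < hcontent delta Q -> 0 < choquet delta Q w.
Proof.
move=> [_ _ [N N0 wN]] Q_gt0; apply: choquet_gt0 => //.
by exists N => // x /wN /andP[].
Qed.

(** The form in which the Muckenhoupt condition is used: a set of large content
    in [Q] on which [w] is small must be seen by the companion [g], whose mean
    on [Q] is small compared to [b].  A single pair of thresholds for the whole
    of [Q], in place of Hölder's inequality on its subcubes, allows the
    resulting bounds to be summed. *)
Definition weight_test {R : realType} {n : nat} (delta theta c W : R)
    (w : 'rV[R]_n -> \bar R) (Q : set 'rV[R]_n) : Prop :=
  exists (a b : R) (g : 'rV[R]_n -> \bar R),
    [/\ (0 < a)%R, (0 < b)%R,
        choquet delta Q w <= (c * W * a)%:E * hcontent delta Q,
        choquet delta Q g <= (theta * b)%:E * hcontent delta Q &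
        content_ae delta (fun x => Q x -> a%:E <= w x \/ b%:E <= g x)].

(** The companion is [sigma = w ^ (- 1 / (p - 1))], and [b] is its mean divided
    by [theta].  Since [w < a] means [sigma > b], the bound on the mean of [w] is
    the [A_p] inequality solved for it. *)
Lemma Ap_weight_test {R : realType} {n : nat} (delta p theta W : R)
    (w : 'rV[R]_n -> \bar R) (Q : set 'rV[R]_n) :
  (1 < p)%R -> (0 < theta)%R -> capacitary_weight delta w ->
  Ap_const delta p w = W%:E -> is_cube Q -> 0 < hcontent delta Q ->
  weight_test delta theta (theta `^ (- (p - 1))) W w Q.
Proof.
move=> p_gt1 theta_gt0 wcap WE cubeQ Q_gt0.
have q_gt0 : (0 < p - 1)%R by rewrite subr_gt0.
set sigma := fun x => (w x `^ (p - 1)^-1)^-1.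
have : choquet_mean delta Q w * (choquet_mean delta Q sigma) `^ (p - 1) <= W%:E.
  by rewrite -WE; apply: ereal_sup_ubound; exists Q.
have u_gt0 := choquet_weight_gt0 _ _ _ wcap Q_gt0.
have u_lty := choquet_weight_cube_lty _ _ _ wcap cubeQ.
have [w_ge0 _ [N N0 wN]] := wcap.
have s_gt0 : 0 < choquet delta Q sigma.
  apply: choquet_gt0 => //; exists N => // x /wN /andP[wx_gt0 wx_lty] _.
  rewrite /sigma inve_gt0 ?poweR_gt0//.
    by rewrite gt_eqF// poweR_gt0.
  by rewrite lt_eqF// poweR_lty.
rewrite /choquet_mean; move: (hcontent_cube_fin_num delta _ cubeQ) Q_gt0 u_gt0 u_lty.
rewrite /weight_test.
case: (hcontent delta Q) => [h| |]// _; rewrite lte_fin => h_gt0.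
case: (choquet delta Q w) => [u| |]//; rewrite lte_fin => u_gt0 _.
rewrite inver gt_eqF//.
(* an infinite integral of sigma would make the A_p constant infinite *)
case sE : (choquet delta Q sigma) s_gt0 => [s| |]//; last first.
  rewrite gt0_muley ?lte_fin ?invr_gt0// poweRyr ?gt_eqF// gt0_muley ?leye_eq//.
  by rewrite lte_fin mulr_gt0 ?invr_gt0.
rewrite lte_fin -!EFinM lee_fin => s_gt0 AW.
(* b makes the bound on the integral of sigma an equality *)
pose b := (s / (theta * h))%R.
have b_gt0 : (0 < b)%R by rewrite divr_gt0// mulr_gt0.
exists (b `^ (- (p - 1)))%R, b, sigma; split => //.
- by rewrite powR_gt0.
- rewrite -EFinM lee_fin [(_ * W * _)%R]mulrAC -(powRM _ (ltW theta_gt0) (ltW b_gt0)).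
  have -> : (theta * b = h^-1 * s)%R.
    by rewrite /b; field; rewrite !gt_eqF.
  rewrite powRN -ler_pdivrMr// [leRHS]mulrC ler_pdivlMr ?powR_gt0 ?mulr_gt0 ?invr_gt0//.
  by rewrite [(u / _)%R]mulrC.
- rewrite sE -EFinM lee_fin le_eqVlt; apply/orP; left; apply/eqP.
  by rewrite /b; field; rewrite !gt_eqF.
exists N => // x /wN /andP[wx_gt0 wx_lty] Qx.
case vE: (w x) wx_gt0 wx_lty => [v| |]// v_gt0 _.
rewrite lee_fin /sigma vE poweR_EFin inver gt_eqF ?powR_gt0//.
have [|/ltW va] := leP (b `^ (- (p - 1)))%R v; [by left|right].
rewrite lee_fin -[b]invrK lef_pV2 ?posrE ?invr_gt0 ?powR_gt0//.
have -> : (b^-1 = (b `^ (- (p - 1))) `^ (p - 1)^-1)%R.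
  by rewrite -powRrM mulNr divff ?gt_eqF// powR_inv1// ltW.
rewrite lte_fin in v_gt0.
by apply: ge0_ler_powR; rewrite ?nnegrE ?powR_ge0 ?invr_ge0 ?(ltW q_gt0) ?(ltW v_gt0).
Qed.

(** For an admissible [K] in the definition of [A1_const], [w] is almost
    everywhere at least its mean over [Q] divided by [K], so that [0] serves as
    companion.  Integrating this lower bound gives [1 <= K]; hence [1 <= W], and
    some admissible [K] is at most [2 * W]. *)
Lemma A1_weight_test {R : realType} {n : nat} (delta theta W : R)
    (w : 'rV[R]_n -> \bar R) (Q : set 'rV[R]_n) :
  (0 < theta)%R -> capacitary_weight delta w ->
  A1_const delta w = W%:E -> is_cube Q -> 0 < hcontent delta Q ->
  weight_test delta theta 2 W w Q.
Proof.
move=> theta_gt0 wcap WE cubeQ Q_gt0.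
have h_fin := hcontent_cube_fin_num delta _ cubeQ.
have u_gt0 := choquet_weight_gt0 _ _ _ wcap Q_gt0.
have u_lty := choquet_weight_cube_lty _ _ _ wcap cubeQ.
have [w_ge0 _ _] := wcap.
have absw : (fun x => `|w x|) = w by apply/funext => x; rewrite gee0_abs.
pose h := fine (hcontent delta Q); pose u := fine (choquet delta Q w).
have hE : hcontent delta Q = h%:E by rewrite fineK.
have uE : choquet delta Q w = u%:E by rewrite fineK// ge0_fin_numE// choquet_ge0.
have h_gt0 : (0 < h)%R by rewrite -lte_fin -hE.
have {u_lty}u_gt0 : (0 < u)%R by rewrite -lte_fin -uE.
have low (K : R) : (0 < K)%R ->
    content_ae delta (fun x => hmaximal delta w x <= K%:E * w x) ->
    content_ae delta (fun x => Q x -> (u / (h * K))%:E <= w x \/ 1%:E <= (0 : \bar R)).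
  move=> K_gt0 [N N0 MN]; exists N => // x /MN Mx Qx; left.
  have : choquet_mean delta Q w <= K%:E * w x.
    apply: le_trans Mx; rewrite -{1}absw.
    by apply: ereal_sup_ubound; exists Q.
  rewrite /choquet_mean uE hE inver gt_eqF// -EFinM -lee_pdivrMl// -EFinM.
  suff -> : (K^-1 * (h^-1 * u) = u / (h * K))%R by [].
  by field; rewrite !gt_eqF.
have ge1 (K : R) : (0 < K)%R ->
    content_ae delta (fun x => hmaximal delta w x <= K%:E * w x) -> (1 <= K)%R.
  move=> K_gt0 /(low _ K_gt0) Klow.
  have a_gt0 : (0 < u / (h * K))%R by rewrite divr_gt0// mulr_gt0.
  have := hcontent_le_levels _ _ _ _ Q _ _ a_gt0 ltr01 (fun x Qx => Qx) Klow.
  rewrite choquet_cst0 mule0 adde0 uE hE -EFinM lee_fin invf_div -mulrA mulVf ?gt_eqF//.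
  by rewrite mulr1 ler_pMr.
have W_ge1 : (1 <= W)%R.
  rewrite -lee_fin -WE; apply/ereal_infP => _ [K [K_gt0 MK] <-].
  by rewrite lee_fin; exact: ge1 MK.
have : A1_const delta w \is a fin_num by rewrite WE.
move=> /(lb_ereal_inf_adherent ltr01)[_ [K [K_gt0 MK] <-]].
rewrite -/(A1_const delta w) WE -EFinD lte_fin => K_lt.
exists (u / (h * K))%R, 1%R, (fun=> 0); split => //.
- by rewrite divr_gt0// mulr_gt0.
- rewrite uE hE -EFinM lee_fin.
  have -> : (2 * W * (u / (h * K)) * h = u * (2 * W / K))%R.
    by field; rewrite !gt_eqF.
  by rewrite ler_peMr ?(ltW u_gt0)// ler_pdivlMr// mul1r; lra.
- by rewrite choquet_cst0 hE -EFinM lee_fin !mulr_ge0 ?ltW.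
- exact: low.
Qed.

Lemma muckenhoupt_weight_test {R : realType} {n : nat} (delta p theta : R) :
  (1 <= p)%R -> (0 < theta)%R ->
  exists2 c : R, (0 < c)%R &
    forall (w : 'rV[R]_n -> \bar R) (W : R) (Q : set 'rV[R]_n),
      capacitary_weight delta w -> muckenhoupt_const delta p w = W%:E ->
      is_cube Q -> 0 < hcontent delta Q -> weight_test delta theta c W w Q.
Proof.
move=> p_ge1 theta_gt0; rewrite /muckenhoupt_const.
have [_|p_neq1] := eqVneq p 1%R.
  by exists 2%R => // w W Q; exact: A1_weight_test.
exists (theta `^ (- (p - 1)))%R; first by rewrite powR_gt0.
move=> w W Q; apply: Ap_weight_test => //.
by rewrite lt_neqAle eq_sym p_neq1.
Qed.

Lemma muckenhoupt_const_fin_num {R : realType} {n : nat} (delta p : R)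
    (w : 'rV[R]_n -> \bar R) :
  muckenhoupt delta p w -> muckenhoupt_const delta p w \is a fin_num.
Proof.
move=> [[w_ge0 _ _] lty]; rewrite ge0_fin_numE//.
move: lty => _; rewrite /muckenhoupt_const; case: ifP => _.
  by apply/ereal_infP => _ [K [K_gt0 _] <-]; rewrite lee_fin ltW.
pose Q := @cube R n 0%R 1%R.
have cubeQ : is_cube Q by exists 0%R, 1%R.
apply: le_trans (ereal_sup_ubound _); last by exists Q; first exact: cubeQ.
rewrite mule_ge0 ?poweR_ge0// /choquet_mean mule_ge0 ?choquet_ge0//.
by rewrite inve_ge0 hcontent_ge0.
Qed.

(** [hcontent_le_levels] on [Q] itself gives [1 <= c * W + theta]. *)
Lemma weight_test_const_ge {R : realType} {n : nat} (delta theta c W : R)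
    (w : 'rV[R]_n -> \bar R) (Q : set 'rV[R]_n) :
  (theta <= 2^-1)%R -> is_cube Q -> 0 < hcontent delta Q ->
  weight_test delta theta c W w Q -> (2^-1 <= c * W)%R.
Proof.
move=> theta_le cubeQ Q_gt0 [a [b [g [a_gt0 b_gt0 le_w le_g wg]]]].
have := hcontent_le_levels _ _ _ _ Q _ _ a_gt0 b_gt0 (fun x Qx => Qx) wg.
move: (hcontent_cube_fin_num delta _ cubeQ) Q_gt0 le_w le_g.
case: (hcontent delta Q) => [h| |]// _; rewrite lte_fin => h_gt0 le_w le_g /le_trans.
move=> /(_ ((c * W + theta) * h)%:E).
rewrite lee_fin -ler_pdivrMr// divff ?gt_eqF// => le1.
suff : (1 <= c * W + theta)%R by lra.
apply: le1; rewrite mulrDl EFinD; apply: leeD.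
  rewrite lee_pdivrMl// (le_trans le_w)// -!EFinM lee_fin.
  by rewrite le_eqVlt; apply/orP; left; apply/eqP; ring.
rewrite lee_pdivrMl// (le_trans le_g)// -!EFinM lee_fin.
by rewrite le_eqVlt; apply/orP; left; apply/eqP; ring.
Qed.

(** * From weighted packing to packing *)

Lemma content_packing_mono {R : realType} {n : nat} (delta : R) (s : seq nat)
    (Q : nat -> set 'rV[R]_n) (S S' : R) :
  (S <= S')%R -> content_packing delta s Q S -> content_packing delta s Q S'.
Proof.
move=> SS' packS P dyP; apply: le_trans (packS P dyP) _.
by rewrite lee_wpmul2r ?hcontent_ge0// lee_fin.
Qed.

(** Each cube counted has content at most that of [P]: a crude constant, from
    which the improvement can start. *)
Lemma content_packing_size {R : realType} {n : nat} (delta : R) (s : seq nat)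
    (Q : nat -> set 'rV[R]_n) : content_packing delta s Q (size s)%:R.
Proof.
move=> P _; elim: s => [|j s IHs].
  by rewrite big_nil mul0e.
rewrite big_cons/= -nat1r EFinD ge0_muleDl ?lee_fin// mul1e.
case: asboolP => [QP|_]; first by apply: leeD => //; exact: le_hcontent.
by apply: (le_trans IHs); rewrite leeDr// hcontent_ge0.
Qed.

(** The value of [theta] is chosen so that the loss in [choquet_packing] for the
    companion of [w] is compensated up to a factor [1 / 2]. *)
Lemma packing_self_improve {R : realType} {n : nat} (delta theta c W beta S : R)
    (w : 'rV[R]_n -> \bar R) (s : seq nat) (Q : nat -> set 'rV[R]_n) :
  (0 < delta)%R ->
  (theta * ((2 ^ n)%:R * 2 `^ delta) = 2^-1)%R ->
  (0 <= beta)%R ->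
  (forall P : set 'rV[R]_n, is_cube P -> weight_test delta theta c W w P) ->
  uniq s -> (forall j, is_dyadic_cube (Q j)) -> trivIset setT Q ->
  (forall D : set 'rV[R]_n, is_dyadic_cube D ->
     \esum_(j in [set j | Q j `<=` D]) choquet delta (Q j) w
       <= beta%:E * choquet delta D w) ->
  (1 <= S)%R ->
  content_packing delta s Q S ->
  content_packing delta s Q (S / 2 + beta * (c * W))%R.
Proof.
move=> delta_gt0 thetaE beta_ge0 test s_uniq dyQ tQ packw S_ge1 packS P dyP.
have cubeP := is_dyadic_is_cube _ dyP.
have [a [b [g [a_gt0 b_gt0 le_w le_g wg]]]] := test _ cubeP.
apply: le_trans (_ : _ <= \sum_(j <- s | `[< Q j `<=` P >])
    (a^-1%:E * choquet delta (Q j) w + b^-1%:E * choquet delta (Q j) g)) _.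
  by apply: lee_sum => j /asboolP QP; exact: hcontent_le_levels wg.
rewrite big_split/= -!ge0_sume_distrr; last 2 first.
- by move=> j _; exact: choquet_ge0.
- by move=> j _; exact: choquet_ge0.
have sum_w : \sum_(j <- s | `[< Q j `<=` P >]) choquet delta (Q j) w
    <= beta%:E * ((c * W * a)%:E * hcontent delta P).
  apply: le_trans (_ : _ <= beta%:E * choquet delta P w) _; last first.
    by apply: lee_wpmul2l; rewrite ?lee_fin.
  apply: le_trans (packw _ dyP).
  by apply: sum_le_esum => // j /asboolP.
have sum_g : \sum_(j <- s | `[< Q j `<=` P >]) choquet delta (Q j) g
    <= ((2 ^ n)%:R * 2 `^ delta * S)%:E * ((theta * b)%:E * hcontent delta P).
  apply: le_trans (_ : _ <= ((2 ^ n)%:R * 2 `^ delta * S)%:E * choquet delta P g) _; last first.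
    by apply: lee_wpmul2l => //; rewrite lee_fin !mulr_ge0 ?powR_ge0// (le_trans ler01).
  apply: le_trans (choquet_packing _ _ _ _ P g delta_gt0 s_uniq dyQ tQ S_ge1 packS).
  rewrite big_mkcond; apply: lee_sum => j _; case: asboolP => [QP|_]; last exact: choquet_ge0.
  by rewrite setIidr.
have hP := hcontent_cube_fin_num delta _ cubeP.
rewrite -(fineK hP) in sum_w sum_g; rewrite -(fineK hP).
rewrite -EFinM in sum_w; rewrite -EFinM in sum_g.
apply: le_trans (leeD (lee_wpmul2l _ sum_w) (lee_wpmul2l _ sum_g)) _.
- by rewrite lee_fin invr_ge0 ltW.
- by rewrite lee_fin invr_ge0 ltW.
rewrite lee_fin le_eqVlt; apply/orP; left; apply/eqP.
set h := fine _.
rewrite [X in (_ + X = _)%R](_ : _ = S * (theta * ((2 ^ n)%:R * 2 `^ delta)) * h)%R.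
  by rewrite thetaE; field; rewrite gt_eqF.
by field; rewrite gt_eqF.
Qed.

(** Iterating [S |-> S / 2 + T + 1 / 2] brings every [S >= 1] below [2 + 2 * T]
    in finitely many steps.  Their number depends on the family [s], through the
    initial constant, but the bound reached does not. *)
Lemma packing_bound {R : realType} {n : nat} (delta theta c W beta : R)
    (w : 'rV[R]_n -> \bar R) (s : seq nat) (Q : nat -> set 'rV[R]_n) :
  (0 < delta)%R ->
  (theta * ((2 ^ n)%:R * 2 `^ delta) = 2^-1)%R ->
  (0 <= beta)%R -> (0 <= c * W)%R ->
  (forall P : set 'rV[R]_n, is_cube P -> weight_test delta theta c W w P) ->
  uniq s -> (forall j, is_dyadic_cube (Q j)) -> trivIset setT Q ->
  (forall D : set 'rV[R]_n, is_dyadic_cube D ->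
     \esum_(j in [set j | Q j `<=` D]) choquet delta (Q j) w
       <= beta%:E * choquet delta D w) ->
  content_packing delta s Q (2 + 2 * (beta * (c * W)))%R.
Proof.
move=> delta_gt0 thetaE beta_ge0 cW_ge0 test s_uniq dyQ tQ packw.
set T : R := (beta * (c * W))%R.
have T_ge0 : (0 <= T)%R by rewrite mulr_ge0.
suff descent (m : nat) (S : R) : (1 <= S)%R -> (S <= 2 + 2 * T + m%:R)%R ->
    content_packing delta s Q S -> content_packing delta s Q (2 + 2 * T)%R.
  apply: (descent (size s) (1 + (size s)%:R)%R); last first.
  - apply: content_packing_mono (content_packing_size delta s Q).
    by rewrite lerDr.
  - by rewrite lerD2r; lra.
  - by rewrite lerDl.
elim: m S => [|m IHm] S S_ge1 S_le packS.
  by apply: content_packing_mono packS; rewrite addr0 in S_le.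
have m_ge0 : (0 <= m%:R :> R)%R by [].
rewrite -natr1 in S_le.
(* adding 1 / 2 keeps the constant at least 1 *)
apply: (IHm (S / 2 + T + 2^-1)%R); [lra|lra|].
apply: (content_packing_mono _ _ _ _ _ _ (packing_self_improve
  _ _ _ _ _ _ _ _ _ delta_gt0 thetaE beta_ge0 test s_uniq dyQ tQ packw S_ge1 packS)).
by rewrite lerDl.
Qed.

Theorem proposition2p12 (R : realType) (n : nat) (delta p : R)
    (hdelta : (0 < delta <= n%:R)%R) (hp : (1 <= p)%R) :
  exists K : R, (0 < K)%R /\
    forall (w : 'rV[R]_n -> \bar R) (Q : nat -> set 'rV[R]_n),
      muckenhoupt delta p w ->
      (forall j, is_dyadic_cube (Q j)) ->
      trivIset setT Q ->
      forall beta : R, (0 < beta)%R ->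
      (forall D : set 'rV[R]_n, is_dyadic_cube D ->
         \esum_(j in [set j | Q j `<=` D]) choquet delta (Q j) w
           <= beta%:E * choquet delta D w) ->
      forall f : 'rV[R]_n -> \bar R,
        L1w delta w (\bigcup_j Q j) f ->
        \esum_(j in [set: nat]) choquet delta (Q j) (fun x => `|f x| * w x)
          <= K%:E * (Num.max 1%R beta)%:E
             * (muckenhoupt_const delta p w) `^ (1 + p^-1)
             * choquet delta (\bigcup_j Q j) (fun x => `|f x| * w x).
Proof.
have delta_gt0 : (0 < delta)%R by have /andP[] := hdelta.
pose C : R := ((2 ^ n)%:R * 2 `^ delta)%R.
have C_gt0 : (0 < C)%R by rewrite mulr_gt0 ?powR_gt0// ltr0n expn_gt0.
have C_ge1 : (1 <= C)%R.
  rewrite -[leLHS]mulr1 ler_pM// ?ler1n ?expn_gt0//.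
  by rewrite -[leLHS](powRr0 2); apply: ler_powR; rewrite ?ler1n// ltW.
pose theta : R := (2^-1 / C)%R.
have theta_gt0 : (0 < theta)%R by rewrite divr_gt0.
have thetaE : (theta * C = 2^-1)%R by rewrite /theta mulfVK ?gt_eqF.
have theta_le : (theta <= 2^-1)%R by rewrite ler_pdivrMr// ler_peMr.
have [c c_gt0 test] := @muckenhoupt_weight_test R n delta p theta hp theta_gt0.
have p_gt0 : (0 < p)%R by exact: lt_le_trans hp.
pose r : R := (2^-1 / c)%R.
have r_gt0 : (0 < r)%R by rewrite divr_gt0.
pose K : R := (C * (6 * c) * r `^ (- p^-1))%R.
have K_gt0 : (0 < K)%R by rewrite !mulr_gt0 ?powR_gt0.
exists K; split => // w Q wA dyQ tQ beta beta_gt0 packw f _.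
pose g (x : 'rV[R]_n) := `|f x| * w x; rewrite -/g; set U := \bigcup_j Q j.
have W_fin := muckenhoupt_const_fin_num _ _ _ wA.
set W := fine (muckenhoupt_const delta p w); have WE := esym (fineK W_fin).
(* if some cube is null, then the content and both sides vanish *)
have [[a [l [l_gt0 cube0]]]|cube_gt0] := pselect (exists (a : 'rV[R]_n) (l : R),
    (0 < l)%R /\ hcontent delta (cube a l) = 0).
  rewrite esum1 => [|j _]; last first.
    by apply: choquet_eq0; exact: hcontent_null_cube l_gt0 cube0.
  rewrite mule_ge0 ?choquet_ge0// mule_ge0 ?poweR_ge0// -EFinM lee_fin.
  by rewrite mulr_ge0 ?ltW// lt_max ltr01.
have {}test (P : set 'rV[R]_n) : is_cube P ->
    0 < hcontent delta P /\ weight_test delta theta c W w P.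
  move=> cubeP; have P_gt0 : 0 < hcontent delta P.
    case: cubeP => a [l [l_gt0 ->]]; rewrite lt0e hcontent_ge0 andbT.
    by apply/eqP => cube0; apply: cube_gt0; exists a, l.
  by split => //; apply: test => //; case: wA.
have cW_ge : (2^-1 <= c * W)%R.
  have cubeP : is_cube (@cube R n 0%R 1%R) by exists 0%R, 1%R.
  have [P_gt0 tP] := test _ cubeP.
  exact: weight_test_const_ge theta_le cubeP P_gt0 tP.
have cW_ge0 : (0 <= c * W)%R by apply: le_trans cW_ge.
apply: ge_ereal_sup => _ [X [finX _] <-].
rewrite fsbig_finite//=; set s := (X in \sum_(_ <- X) _).
have s_uniq : uniq s by exact: finmap.fset_uniq.
have bound := packing_bound _ _ _ _ _ _ _ _ delta_gt0 thetaE (ltW beta_gt0) cW_ge0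
  (fun P cP => (test P cP).2) s_uniq dyQ tQ packw.
have S_ge1 : (1 <= 2 + 2 * (beta * (c * W)))%R.
  by have := mulr_ge0 (ltW beta_gt0) cW_ge0; lra.
have sum_le := choquet_packing _ _ _ _ U g delta_gt0 s_uniq dyQ tQ S_ge1 bound.
apply: le_trans (_ : _ <= \sum_(j <- s) choquet delta (U `&` Q j) g) _.
  apply: lee_sum => j _; apply: le_choquet => x Qjx.
  by split => //; exists j.
apply: le_trans sum_le _.
rewrite WE -/W poweR_EFin -!EFinM; apply: lee_wpmul2r; first exact: choquet_ge0.
rewrite lee_fin -/C.
have W_ge : (r <= W)%R by rewrite /r ler_pdivrMr// mulrC.
have W_gt0 : (0 < W)%R by exact: lt_le_trans W_ge.
set m := Num.max 1%R beta.
have m_ge1 : (1 <= m)%R by rewrite le_max lexx.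
have m_ge_beta : (beta <= m)%R by rewrite le_max lexx orbT.
(* r is a lower bound of W, so the factor W ^ (1 / p) costs r ^ (- 1 / p) *)
have -> : (K * m * W `^ (1 + p^-1)
    = C * (6 * (m * (c * W))) * (r `^ (- p^-1) * W `^ p^-1))%R.
  rewrite powRD; last by rewrite (gt_eqF W_gt0) implybT.
  by rewrite powRr1 ?ltW// /K; ring.
apply: le_trans (_ : _ <= C * (6 * (m * (c * W))))%R _.
  rewrite ler_pM2l//.
  have := ler_wpM2r cW_ge0 m_ge_beta; have := ler_wpM2r cW_ge0 m_ge1.
  lra.
rewrite ler_peMr//.
  by rewrite !mulr_ge0// ltW// (lt_le_trans ltr01).
rewrite powRN mulrC ler_pdivlMr ?powR_gt0// mul1r.
apply: ge0_ler_powR => //; rewrite ?nnegrE ?(ltW r_gt0) ?(ltW W_gt0)//.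
by rewrite invr_ge0 ltW.
Qed.
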